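(* Let $\alpha\in(0,1)$, $\kappa>0$, $T>0$, $N\in\mathbb{N}$, $\tau=T/N$, $S>0$, and let $\Omega\subset\mathbb{R}^d$, $d\in\{1,2,3\}$, be a bounded smooth domain. (a) The weighted convex splitting (WCS) scheme: given $u_0$, find $u_n$ with $$\bar\partial_\tau^\alpha u_n-\kappa^2\Delta u_n=u_{n,\alpha}-(u_n)^3\ \text{ in }\Omega,\qquad u_n=0\ \text{ on }\partial\Omega,\qquad 1\le n\le N,$$ satisfies the discrete maximum principle unconditionally (i.e. for every $\tau$): if $\|u_0\|_{L^\infty(\Omega)}\le1$, then $\|u_n\|_{L^\infty(\Omega)}\le1$ for all $n\ge1$. (b) The linear weighted stabilized (LWS) scheme: given $u_0$, find $u_n$ with $$\bar\partial_\tau^\alpha u_n-\kappa^2\Delta u_n=u_{n,\alpha}-(u_{n,\alpha})^3-S(u_n-u_{n,\alpha})\ \text{ in }\Omega,\qquad u_n=0\ \text{ on }\partial\Omega,\qquad 1\le n\le N,$$ satisfies the discrete maximum principle under the constraint $S+\tau^{-\alpha}\ge2$: if $\|u_0\|_{L^\infty(\Omega)}\le1$, then $\|u_n\|_{L^\infty(\Omega)}\le1$ for all $n\ge1$.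
   Context: The backward Euler convolution quadrature is $\bar\partial_\tau^\alpha u_n=\tau^{-\alpha}\sum_{j=1}^n\omega_{n-j}(u_j-u_0)$, with $\omega_0=1$ and $\omega_j=(-1)^j\frac{\alpha(\alpha-1)\cdots(\alpha-j+1)}{j!}$ for $j\ge1$. The fractional extrapolation is $u_{n,\alpha}=u_n-\tau^\alpha\bar\partial_\tau^\alpha u_n=u_0-\sum_{j=1}^{n-1}\omega_{n-j}(u_j-u_0)$; it depends only on $u_0,\dots,u_{n-1}$. The schemes are discrete in time and continuous in space; at each step each is a uniquely solvable elliptic problem for $u_n\in H_0^1(\Omega)$. *)

(* Defs.v *)
From HB Require Import structures.
From mathcomp Require Import all_boot all_order all_algebra.
From mathcomp Require Import all_classical all_reals all_analysis.

Set Implicit Arguments.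
Unset Strict Implicit.
Unset Printing Implicit Defensive.

Import Order.TTheory GRing.Theory Num.Theory.
Import numFieldNormedType.Exports.

Local Open Scope classical_set_scope.
Local Open Scope ring_scope.

(* The library has a product sigma-algebra on tuples but not on row vectors,
   which are the ones that carry the normed-module structure. *)

Definition measure_rV_display : measure_display -> measure_display.
Proof. exact. Qed.

Section measurable_rV.
Context {disp : measure_display} {X : measurableType disp} (n : nat).

Let coords : 'I_n -> 'rV[X]_n -> X := fun i x => x ord0 i.

Let rV_set0 : g_sigma_preimage coords set0.
Proof. exact: sigma_algebra0. Qed.

Let rV_setC A : g_sigma_preimage coords A -> g_sigma_preimage coords (~` A).
Proof. exact: sigma_algebraC. Qed.

Let rV_bigcup (F : _^nat) : (forall i, g_sigma_preimage coords (F i)) ->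
  g_sigma_preimage coords (\bigcup_i (F i)).
Proof. exact: sigma_algebra_bigcup. Qed.

HB.instance Definition _ := @isMeasurable.Build (measure_rV_display disp)
  'rV[X]_n (g_sigma_preimage coords) rV_set0 rV_setC rV_bigcup.

Lemma measurable_rV_coord (i : 'I_n) :
  measurable_fun [set: 'rV[X]_n] (fun x : 'rV[X]_n => x ord0 i).
Proof.
move=> _ Y mY; rewrite setTI; apply: sub_sigma_algebra => /=.
rewrite -bigcup_seq/=; exists i => /=; first by rewrite mem_index_enum.
by exists Y => //; rewrite setTI.
Qed.

Lemma measurable_fun_rVP d1 (T1 : measurableType d1) (f : T1 -> 'rV[X]_n) :
  (forall i, measurable_fun [set: T1] (fun t => f t ord0 i)) ->
  measurable_fun [set: T1] f.
Proof.
move=> mf _ Y mY; rewrite setTI; move: Y mY.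
suff : g_sigma_preimage coords `<=`
    [set Y | measurable (f @^-1` Y)] by move=> h Y /h.
apply: smallest_sub.
  split=> /=.
  - by rewrite preimage_set0.
  - by move=> A mA; rewrite setTD -preimage_setC; exact: measurableC.
  - by move=> F mF; rewrite preimage_bigcup; exact: bigcup_measurable.
rewrite -bigcup_seq => A [i _ [B mB <-]] /=.
by rewrite setTI -comp_preimage -[X in measurable X]setTI; exact: mf.
Qed.

End measurable_rV.

Section lebesgue_rV.
Context {R : realType}.

Definition cons_rV n (p : 'rV[R]_n * measurableTypeR R) : 'rV[R]_n.+1 :=
  \row_i oapp (p.1 ord0) p.2 (unlift ord0 i).

Lemma measurable_cons_rV n : measurable_fun setT (@cons_rV n).
Proof.
apply: measurable_fun_rVP => i.
case: (unliftP ord0 i) => [j|] ->.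
  rewrite (_ : (fun _ => _) = (fun x : 'rV[R]_n => x ord0 j) \o fst); last first.
    by apply/funext => p; rewrite /= mxE liftK.
  by apply: measurableT_comp => //; exact: measurable_rV_coord.
rewrite (_ : (fun _ => _) = snd) //.
by apply/funext => p; rewrite /= mxE unlift_none.
Qed.

Section extend_rV.
Context (n : nat) (m : {measure set 'rV[R]_n -> \bar R}).

Definition extend_rV : set 'rV[R]_n.+1 -> \bar R :=
  pushforward (m \x lebesgue_measure)%E (@cons_rV n).

HB.instance Definition _ := Measure.copy extend_rV
  (measure_function_pushforward__canonical__measure_function_Measure
    (m \x lebesgue_measure)%E (@measurable_cons_rV n)).

End extend_rV.

(* Borel version: the sigma-algebra is the product one, not its completion,
   so every Lebesgue-measurable function is represented up to a null set. *)
Fixpoint lebesgue_rV n : {measure set 'rV[R]_n -> \bar R} :=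
  match n with
  | 0%N => \d_(0 : 'rV[R]_0)
  | n'.+1 => extend_rV (lebesgue_rV n')
  end.

Lemma lebesgue_rV_box n (A : 'I_n -> set R) :
  (forall i, measurable (A i)) ->
  lebesgue_rV n [set x | forall i, A i (x ord0 i)] =
  (\prod_(i < n) lebesgue_measure (A i))%E.
Proof.
elim: n A => [|n IHn] A mA /=.
  by rewrite big_ord0 diracE mem_set// => -[].
pose B := [set x : 'rV[R]_n | forall i, A (lift ord0 i) (x ord0 i)].
have mB : measurable B.
  rewrite (_ : B = \bigcap_(i in [set: 'I_n])
      ((fun x : 'rV[R]_n => x ord0 i) @^-1` A (lift ord0 i))).
    apply: fin_bigcap_measurable => // i _.
    rewrite -[X in measurable X]setTI.
    by apply: measurable_rV_coord => //; exact: mA.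
  by apply/seteqP; split => x /= h i => [_|]; exact: h.
rewrite big_ord_recl -(IHn (fun i => A (lift ord0 i))) => [|i]; last exact: mA.
rewrite muleC -product_measure1E//; last exact: mA.
congr (product_measure1 _ _ _); apply/seteqP; split => -[v t] /=.
  move=> h; split=> [i|].
    by move: (h (lift ord0 i)); rewrite mxE liftK.
  by move: (h ord0); rewrite mxE unlift_none.
move=> [h1 h2] i; rewrite mxE; case: unliftP => [j|] -> //=; exact: h1.
Qed.

End lebesgue_rV.

Section smooth.
Context {R : realType} {d : nat}.
Implicit Types (f phi : 'rV[R]_d -> R) (Omega : set 'rV[R]_d).

Definition partial (i : 'I_d) f : 'rV[R]_d -> R :=
  fun x => 'D_(delta_mx ord0 i) f x.

Definition smooth f := forall (s : seq 'I_d) (x : 'rV[R]_d),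
  differentiable (foldr partial f s) x.

(* Near each boundary point, Omega is a sublevel set of a smooth function with
   nonvanishing gradient.  Taking that function smooth on the whole space is no
   restriction, by multiplying a local one by a cutoff. *)
Definition smooth_boundary Omega := forall x,
  (closure Omega `\` Omega^°) x ->
  exists (r : R) (phi : 'rV[R]_d -> R),
    [/\ 0 < r, smooth phi, (exists i, partial i phi x != 0) &
      forall y, ball x r y -> Omega y <-> phi y < 0].

Definition bounded_smooth_domain Omega :=
  [/\ open Omega, connected Omega, Omega !=set0, bounded_set Omega &
      smooth_boundary Omega].

(* C_c^oo(Omega) *)
Definition test_function Omega phi :=
  [/\ smooth phi, compact (closure [set x | phi x != 0]) &
      closure [set x | phi x != 0] `<=` Omega].

End smooth.

Section Sobolev.
Context {R : realType} {d : nat} (Omega : set 'rV[R]_d).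
Implicit Types (u v f w : 'rV[R]_d -> R) (G H : 'I_d -> 'rV[R]_d -> R).

Local Notation mu := (@lebesgue_rV R d).

(* The norm of L^p(Omega), through the extension by zero outside Omega. *)
Definition Lp_norm (p : \bar R) f : \bar R :=
  ('N[mu]_p[EFin \o (f \_ Omega)])%E.

Definition L2 f := measurable_fun Omega f /\ (Lp_norm 2%:E f < +oo)%E.

Definition weak_gradient u G := forall (i : 'I_d) (phi : 'rV[R]_d -> R),
  test_function Omega phi ->
  \int[mu]_(x in Omega) (u x * partial i phi x) =
  - \int[mu]_(x in Omega) (G i x * phi x).

(* u is in H^1(Omega) and G is its weak gradient *)
Definition H1 u G := [/\ L2 u, (forall i, L2 (G i)) & weak_gradient u G].

(* u is in H^1_0(Omega), the closure of C_c^oo(Omega) in H^1(Omega), and G is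
   its weak gradient *)
Definition H10 u G := H1 u G /\
  exists phi : nat -> 'rV[R]_d -> R,
    [/\ forall k, test_function Omega (phi k),
        (fun k => Lp_norm 2%:E (phi k \- u)) @ \oo --> 0%E &
        forall i, (fun k => Lp_norm 2%:E (partial i (phi k) \- G i)) @ \oo
                  --> 0%E].

(* u is a weak solution of  w - kappa^2 Delta u = f  in Omega,  u = 0  on the
   boundary.  The two integrability clauses say that the pairings with the test
   function are genuine, Rintegral being total.  They are automatic in the
   schemes below when d <= 3 and u_0 is bounded, as H^1_0(Omega) then embeds
   in L^6(Omega). *)
Definition weak_solution (kappa : R) w u f := exists2 G, H10 u G &
  forall v H, H10 v H ->
    [/\ mu.-integrable Omega (EFin \o (w \* v)),
        mu.-integrable Omega (EFin \o (f \* v)) &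
        \int[mu]_(x in Omega) (w x * v x)
        + kappa ^+ 2 * \sum_(i < d) \int[mu]_(x in Omega) (G i x * H i x)
        = \int[mu]_(x in Omega) (f x * v x)].

End Sobolev.

Section schemes.
Context {R : realType} {d : nat}.
Implicit Types (alpha tau kappa S : R) (u : nat -> 'rV[R]_d -> R).

Definition omega alpha (j : nat) : R :=
  (-1) ^+ j * (\prod_(i < j) (alpha - i%:R)) / j`!%:R.

Definition dbar alpha tau u (n : nat) : 'rV[R]_d -> R := fun x =>
  tau `^ (- alpha) * \sum_(1 <= j < n.+1) omega alpha (n - j) * (u j x - u 0%N x).

Definition extrap alpha tau u (n : nat) : 'rV[R]_d -> R := fun x =>
  u n x - tau `^ alpha * dbar alpha tau u n x.

Definition WCS Omega alpha kappa tau (N : nat) u :=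
  forall n, (1 <= n <= N)%N ->
  weak_solution Omega kappa (dbar alpha tau u n) (u n)
    (fun x => extrap alpha tau u n x - u n x ^+ 3).

Definition LWS Omega alpha kappa tau S (N : nat) u :=
  forall n, (1 <= n <= N)%N ->
  weak_solution Omega kappa (dbar alpha tau u n) (u n)
    (fun x => extrap alpha tau u n x - extrap alpha tau u n x ^+ 3
              - S * (u n x - extrap alpha tau u n x)).

End schemes.

(* Main.v *)
(* With g the extrapolation of u_0, ..., u_(n-1), both schemes have the form
   w - kappa^2 Delta u_n = f with w = tau^(-alpha) (u_n - g).  The quadrature
   weights make g a convex combination of the earlier iterates, so |g| <= 1 by
   induction.  Test the equation with v = Phi(u_n), where Phi is smooth and
   nondecreasing, vanishes on [-1, 1] and is positive above 1, negative below
   -1.  The gradient term is nonnegative, so the integral of (w - f) v is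
   nonpositive; but w - f has the sign of u_n wherever |u_n| > 1, so the
   integrand is nonnegative.  Hence it vanishes and |u_n| <= 1 almost
   everywhere.

   That Phi(u) lies in H^1_0 follows by approximating u with test functions
   phi_k: each Phi(phi_k) is again a test function, and its gradient
   Phi'(phi_k) grad phi_k converges in L^2.  Smoothness of Phi is what keeps the
   approximants inside C_c^oo without mollification.  The only integration by
   parts needed is that of a smooth function against a test function, which
   comes from the translation invariance of Lebesgue measure and dominated
   convergence of difference quotients. *)

Require Import Defs.
From HB Require Import structures.
From mathcomp Require Import all_boot all_order all_algebra.
From mathcomp Require Import all_classical all_reals all_analysis.
From mathcomp Require Import measurable_realfun ess_sup_inf ring lra.

Set Implicit Arguments.
Unset Strict Implicit.
Unset Printing Implicit Defensive.

Import Order.TTheory GRing.Theory Num.Theory.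
Import numFieldNormedType.Exports.

Local Open Scope classical_set_scope.
Local Open Scope ring_scope.

(** * Borel sets and translation invariance on row vectors *)

Section borel_rV.
Context {R : realType} {n : nat}.
Implicit Types (U : set 'rV[R]_n) (v : 'rV[R]_n).

Definition box (A : 'I_n -> set R) : set 'rV[R]_n :=
  [set x | forall i, A i (x ord0 i)].

Lemma measurable_box (A : 'I_n -> set R) :
  (forall i, measurable (A i)) -> measurable (box A).
Proof.
move=> mA; rewrite (_ : box A = \bigcap_(i in [set: 'I_n])
    ((fun x : 'rV[R]_n => x ord0 i) @^-1` A i)).
  apply: fin_bigcap_measurable => // i _.
  by rewrite -[X in measurable X]setTI; apply: measurable_rV_coord.
by apply/seteqP; split => x /= h i => [_|]; exact: h.
Qed.

(** The norm on row vectors is the sup norm, so balls are cubes. Positivity of [e] matters for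
    [n = 0], where a box is the whole space. *)
Lemma ball_rV v (e : R) : 0 < e -> ball v e = box (fun i => ball (v ord0 i) e).
Proof.
move=> e0; apply/seteqP; split => x.
  by move=> [_ h] i; exact: h.
by move=> h; split => // i j; rewrite ord1; exact: h.
Qed.

(** The sigma-algebra is generated by the coordinates, not by the topology. Second countability
    links the two: [U] is the union of the countably many cubes with rational centre and radius
    1/(k+1) that it contains. *)
Lemma open_measurable_rV U : open U -> measurable U.
Proof.
move=> oU.
pose c (p : 'rV[rat]_n * nat) : set 'rV[R]_n :=
  ball (map_mx (@ratr R) p.1 : 'rV[R]_n) (p.2.+1%:R^-1 : R).
(* Indices that code no cube, or a cube not contained in [U], contribute the empty set. *)
pose F k := if unpickle k is Some p then
  if `[< c p `<=` U >] then c p else set0 else set0.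
have -> : U = \bigcup_k F k.
  apply/seteqP; split => [x Ux|x [k _]]; last first.
    rewrite /F; case: (unpickle k) => [p|//].
    by case: asboolP => // + cx; apply.
  have /nbhs_ballP [e /= e0 eU] := open_nbhs_nbhs (conj oU Ux).
  (* A cube of radius below e/2 that contains [x] lies in the ball of radius [e] around [x]. *)
  have [k ke] : exists k, (k.+1%:R^-1 : R) < e / 2.
    have e20 : 0 < e / 2 by rewrite divr_gt0.
    by near \oo => k; exists k; near: k; exact: near_infty_natSinv_lt (PosNum e20).
  have k0 : 0 < k.+1%:R^-1 :> R by rewrite invr_gt0.
  have /choice [q qx] : forall i, exists q : rat,
      ball (x ord0 i) (k.+1%:R^-1 : R) (ratr q).
    move=> i; have [|q] := @rat_in_itvoo R (x ord0 i - k.+1%:R^-1) (x ord0 i + k.+1%:R^-1).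
      by rewrite ltrD2l gtrN.
    rewrite in_itv/= => /andP[h1 h2]; exists q.
    by rewrite /ball/= ltr_distlC h1 h2.
  pose p := (\row_i q i, k).
  have cx : c p x.
    rewrite /c ball_rV// => i /=; rewrite !mxE.
    by apply: ball_sym; exact: qx.
  exists (pickle p) => //.
  rewrite /F pickleK asboolT// => y cy; apply: eU.
  apply: (@ball_split _ _ (map_mx (@ratr R) p.1 : 'rV[R]_n)).
    by apply: ball_sym; apply: le_ball cx; rewrite ltW.
  by apply: le_ball cy; rewrite ltW.
apply: bigcup_measurable => k _; rewrite /F.
case: (unpickle k) => [p|//]; case: asboolP => // _.
rewrite /c ball_rV ?invr_gt0//; apply: measurable_box => i.
exact: measurable_ball.
Unshelve. all: by end_near. Qed.

Lemma continuous_measurable_rV (f : 'rV[R]_n -> R) :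
  continuous f -> measurable_fun [set: 'rV[R]_n] f.
Proof.
move=> cf; apply: (measurability _ (RGenOpens.measurableE R)).
move=> _ [_ [a [b ->] <-]]; rewrite setTI; apply: open_measurable_rV.
by apply: open_comp; [move=> x _; exact: cf|exact: interval_open].
Qed.

End borel_rV.

Section translation.
Context {R : realType}.

Lemma measurable_addr (t : R) :
  measurable_fun [set: measurableTypeR R]
    ((fun x : R => x + t) : measurableTypeR R -> measurableTypeR R).
Proof. by apply: measurable_funD. Qed.

(** Lebesgue measure is determined by its values on half-open intervals, and translation preserves
    their length. *)
Lemma lebesgue_measure_translate (t : R) (A : set (measurableTypeR R)) :
  measurable A ->
  lebesgue_measure ((fun x : R => x + t) @^-1` A) = lebesgue_measure A.
Proof.
move=> mA; rewrite -[LHS]/(pushforward lebesgue_measure (fun x : R => x + t) A).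
apply/esym.
have := @lebesgue_measure_unique R
  (measure_function_pushforward__canonical__measure_function_Measure
     lebesgue_measure (measurable_addr t)).
apply => // _ [[a b] _ <-] /=; rewrite /pushforward.
rewrite (_ : (_ @^-1` _) = `]a - t, b - t]%classic); last first.
  by apply/seteqP; split => x /=; rewrite !in_itv/= ltrBlDr lerBrDr.
rewrite !lebesgue_measure_itv/= !lte_fin ltrD2r.
by case: ifPn => // _; rewrite -!EFinB; congr EFin; ring.
Qed.

Lemma measurable_translate n (v : 'rV[R]_n) :
  measurable_fun [set: 'rV[R]_n] (fun x => x + v).
Proof.
apply: measurable_fun_rVP => i; under eq_fun do rewrite mxE.
by apply: measurable_funD => //; exact: measurable_rV_coord.
Qed.

(** Measurable boxes are stable under intersection and generate the sigma-algebra, and the cubes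
    [-k, k]^n of finite measure exhaust the space. It thus suffices to compare the two measures on
    boxes, where they are products and one-dimensional invariance applies to each factor. *)
Lemma lebesgue_rV_translate n (v : 'rV[R]_n) (A : set 'rV[R]_n) :
  measurable A ->
  lebesgue_rV n ((fun x => x + v) @^-1` A) = lebesgue_rV n A.
Proof.
move=> mA; rewrite -[LHS]/(pushforward (lebesgue_rV n) (fun x => x + v) A).
apply/esym.
pose G := [set B : set 'rV[R]_n | exists2 A, (forall i, measurable (A i)) & B = box A].
pose g (k : nat) := @box R n (fun=> `[- k%:R, k%:R]%classic).
have := @measure_unique _ R _ G g _ _ _ _ (lebesgue_rV n)
  (measure_function_pushforward__canonical__measure_function_Measure
     (lebesgue_rV n) (measurable_translate v)).
apply => //.
- apply/seteqP; split; last first.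
    apply: smallest_sub; first exact: sigma_algebra_measurable.
    by move=> _ [B mB ->]; exact: measurable_box.
  apply: smallest_sub; first exact: smallest_sigma_algebra.
  rewrite -bigcup_seq => B [i _ [C mC <-]]; apply: sub_sigma_algebra; rewrite /G /=.
  (* A generating cylinder is a box whose sides other than the i-th are the whole line. *)
  exists (fun j => if j == i then C else setT) => [j|]; first by case: ifP.
  apply/seteqP; split => x /=.
    by move=> [_ Cx] j; case: eqP => [->|].
  by move=> /(_ i); rewrite eqxx.
- move=> _ _ [B mB ->] [C mC ->]; exists (fun i => B i `&` C i).
    by move=> i; exact: measurableI.
  apply/seteqP; split => x /=.
    by move=> [h1 h2] i; split; [exact: h1|exact: h2].
  by move=> h; split => i; have [] := h i.
- by move=> k; exists (fun=> `[- k%:R, k%:R]%classic) => // i; exact: measurable_itv.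
- apply/seteqP; split => // x _.
  have bx := archi_boundP (normr_ge0 x).
  exists (Num.bound `|x|) => // i /=; rewrite in_itv/= -ler_norml.
  have : ball (0 : 'rV[R]_n) (Num.bound `|x|)%:R x.
    by rewrite -ball_normE /ball_/= sub0r normrN.
  rewrite ball_rV ?(le_lt_trans _ bx)// => /(_ i).
  by rewrite /ball/= mxE sub0r normrN => /ltW.
- move=> _ [B mB ->]; rewrite /= /pushforward/=.
  rewrite (_ : _ @^-1` _ =
      box (fun i => (fun x => x + v ord0 i) @^-1` B i)); last first.
    by apply/seteqP; split => x h i; move: (h i); rewrite /= mxE.
  rewrite lebesgue_rV_box// lebesgue_rV_box; last first.
    move=> i; rewrite -[X in measurable X]setTI.
    exact: (measurable_addr (v ord0 i) measurableT (mB i)).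
  by apply: eq_bigr => i _; apply/esym; exact: (lebesgue_measure_translate (v ord0 i) (mB i)).
- move=> k; rewrite lebesgue_rV_box => [|i]; last exact: measurable_itv.
  rewrite ltey_eq; apply/orP; left; rewrite (big_ind (fun x => x \is a fin_num))//.
    by move=> *; exact: fin_numM.
  by move=> i _; rewrite /= lebesgue_measure_itv/=; case: ifP.
Qed.

Lemma integral_translate n (v : 'rV[R]_n) (f : 'rV[R]_n -> \bar R) :
  (lebesgue_rV n).-integrable [set: 'rV[R]_n] f ->
  (\int[lebesgue_rV n]_x f (x + v)%R = \int[lebesgue_rV n]_x f x)%E.
Proof.
move=> intf.
have mf : measurable_fun [set: 'rV[R]_n] f by have /integrableP[] := intf.
rewrite integralE [RHS]integralE.
(* The nonnegative case is the change of variables for a pushforward measure; it is then applied to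
   the positive and negative parts. *)
have h (g : 'rV[R]_n -> \bar R) : measurable_fun [set: 'rV[R]_n] g -> (forall x, 0 <= g x)%E ->
   (\int[lebesgue_rV n]_x g (x + v)%R = \int[lebesgue_rV n]_x g x)%E.
  move=> mg g0; have := @ge0_integral_pushforward _ _ _ _ R _
    (measurable_translate v) (lebesgue_rV n) setT g measurableT mg (fun x _ => g0 x).
  rewrite preimage_setT => <-.
  apply: eq_measure_integral => /= [|mv B mB _]; last exact: lebesgue_rV_translate.
  exact: (measurable_translate v).
congr (_ - _)%E.
- rewrite -(h f^\+%E); [|exact: measurable_funepos|exact: funepos_ge0].
  by apply: eq_integral => x _; rewrite !funeposE.
- rewrite -(h f^\-%E); [|exact: measurable_funeneg|exact: funeneg_ge0].
  by apply: eq_integral => x _; rewrite !funenegE.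
Qed.

End translation.

(** * Compactly supported functions *)

Section compact_support.
Context {R : realType} {d : nat}.
Implicit Types (f g h : 'rV[R]_d -> R) (M C : R).
Local Notation mu := (@lebesgue_rV R d).

Lemma lebesgue_rV_ball_fin_num (x : 'rV[R]_d) M :
  0 < M -> mu (ball x M) \is a fin_num.
Proof.
move=> M0; rewrite ball_rV// lebesgue_rV_box => [|i]; last exact: measurable_ball.
rewrite (big_ind (fun x => x \is a fin_num))//.
  by move=> *; exact: fin_numM.
by move=> i _; rewrite lebesgue_measure_ball ?ltW.
Qed.

Lemma measurable_ball_rV (x : 'rV[R]_d) M : 0 < M -> measurable (ball x M).
Proof. by move=> M0; apply: open_measurable_rV; exact: ball_open. Qed.

Lemma integrable_ball_cst M C : 0 < M ->
  mu.-integrable [set: 'rV[R]_d] (EFin \o (fun x => C * \1_(ball 0 M) x)).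
Proof.
move=> M0; have mB := measurable_ball_rV (0 : 'rV[R]_d) M0.
have /(integrable_mkcond _ mB) : mu.-integrable (ball 0 M) (EFin \o cst C).
  apply: measurable_bounded_integrable => //.
    by rewrite ltey_eq lebesgue_rV_ball_fin_num.
  exists `|C|; split; first exact: normr_real.
  by move=> K CK x _; exact: ltW.
apply: eq_integrable => // x _; rewrite patchE/= indicE.
by case: ifP; rewrite ?mulr1 ?mulr0.
Qed.

Lemma ball_dominated f M C x : (forall x, `|f x| <= C) ->
  (forall x, f x != 0 -> ball 0 M x) -> `|f x| <= C * \1_(ball 0 M) x.
Proof.
move=> fC fM; rewrite indicE; case: (boolP (x \in _)) => [_|].
  by rewrite mulr1.
rewrite notin_setE => xM; rewrite mulr0 normr_le0.
by have [//|/fM/xM] := eqVneq (f x) 0.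
Qed.

Lemma integrable_bounded_support f M C : 0 < M ->
  measurable_fun [set: 'rV[R]_d] f -> (forall x, `|f x| <= C) ->
  (forall x, f x != 0 -> ball 0 M x) ->
  mu.-integrable [set: 'rV[R]_d] (EFin \o f).
Proof.
move=> M0 mf fC fM; apply: (le_integrable _ _ _ (integrable_ball_cst C M0)) => //=.
  exact/measurable_EFinP.
by move=> x _; rewrite lee_fin (le_trans (ball_dominated x fC fM))// ler_norm.
Qed.

Definition compact_support f := compact (closure [set x | f x != 0]).

Lemma compact_support_ball f : compact_support f ->
  exists2 M, 0 < M & forall x, f x != 0 -> ball 0 M x.
Proof.
move=> /compact_bounded [M [_ hM]]; exists (`|M| + 2) => [|x fx].
  by rewrite (lt_le_trans (ltr0Sn _ 1))// lerDr.
rewrite -ball_normE /ball_/= sub0r normrN.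
apply: (@le_lt_trans _ _ (`|M| + 1)); last by rewrite ltrD2l ltr1n.
by apply: hM; [rewrite ltr_pwDr// ler_norm|exact: subset_closure].
Qed.

Lemma compact_support_bounded f : continuous f -> compact_support f ->
  exists2 C, 0 < C & forall x, `|f x| <= C.
Proof.
move=> cf sf.
have /compact_bounded [M [_ hM]] : compact (f @` closure [set x | f x != 0]).
  by apply: continuous_compact => //; exact: continuous_subspaceT.
exists (`|M| + 1) => [|x]; first by rewrite ltr_wpDl.
have [->|fx] := eqVneq (f x) 0; first by rewrite normr0 addr_ge0.
apply: hM; first by rewrite ltr_pwDr// ler_norm.
by exists x => //; exact: subset_closure.
Qed.

Lemma integrable_compact_support f : continuous f -> compact_support f ->
  mu.-integrable [set: 'rV[R]_d] (EFin \o f).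
Proof.
move=> cf sf.
have [M M0 hM] := compact_support_ball sf.
have [C _ hC] := compact_support_bounded cf sf.
by apply: (integrable_bounded_support M0 _ hC hM); exact: continuous_measurable_rV.
Qed.

(** Off the closed support [f] vanishes on a whole neighbourhood, hence so does its derivative at
    the point. *)
Lemma partial_support i f : 
  [set x | partial i f x != 0] `<=` closure [set x | f x != 0].
Proof.
move=> x /= fx; apply: contrapT => nx; move: fx; apply/negP/negPn/eqP.
have : \forall y \near x, f y = cst 0 y.
  have : nbhs x (~` closure [set x | f x != 0]).
    apply: open_nbhs_nbhs; split => //.
    by apply: closed_openC; exact: closed_closure.
  apply: filterS => y /= ny; apply/eqP/negPn/negP => fy; apply: ny.
  exact: subset_closure.
by move=> /(near_eq_derive (delta_mx ord0 i)); rewrite /partial => ->; rewrite derive_cst.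
Qed.

Lemma compact_support_partial i f :
  compact_support f -> compact_support (partial i f).
Proof.
move=> sf; apply: subclosed_compact sf _; first exact: closed_closure.
rewrite [X in _ `<=` X](closure_id _).1; last exact: closed_closure.
exact: (closure_subset (@partial_support i f)).
Qed.

(** The difference quotients along the line are those defining the partial derivative. This form
    lets the one-variable mean value theorem bound the quotients of [f]. *)
Lemma is_derive_line i f (x : 'rV[R]_d) (s : R) :
  (forall x, differentiable f x) ->
  is_derive s 1 (fun s : R => f (s *: delta_mx ord0 i + x))
    (partial i f (s *: delta_mx ord0 i + x)).
Proof.
move=> df; set y := s *: _ + x; set g := fun s => _.
have E : (fun h : R => h^-1 *: (g (h *: (1 : R) + s) - g s)) =
    (fun h : R => h^-1 *: (f (h *: delta_mx ord0 i + y) - f y)).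
  by apply/funext => h; rewrite /g /y /GRing.scale/= mulr1 addrA -scalerDl.
apply: DeriveDef; last by rewrite /partial /derive /= E.
have := @diff_derivable _ _ _ f y (delta_mx ord0 i) (df y).
by rewrite /derivable /= E.
Qed.

(** The difference quotients have zero integral by translation invariance and converge pointwise to
    the partial derivative. They are bounded by a constant on a fixed ball and vanish outside it, so
    dominated convergence applies. *)
Lemma integral_partial_eq0 i f : (forall x, differentiable f x) ->
  continuous (partial i f) -> compact_support f ->
  (\int[mu]_x (partial i f x)%:E = 0)%E.
Proof.
move=> df cdf sf.
have cf : continuous f by move=> x; exact: differentiable_continuous.
have [M M0 hM] := compact_support_ball sf.
have [C C0 hC] := compact_support_bounded cdf (compact_support_partial sf).
pose e : 'rV[R]_d := delta_mx ord0 i.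
(* Steps of length at most 1 keep the supports of all translates inside the ball of radius
   [M + 1]. *)
pose t (k : nat) : R := k.+1%:R^-1.
have t0 k : 0 < t k by rewrite invr_gt0.
have t1 k : t k <= 1 by rewrite invf_le1// ler1n.
pose q k x := (t k)^-1 * (f (x + t k *: e) - f x).
have mf := continuous_measurable_rV cf.
have mft k : measurable_fun [set: 'rV[R]_d] (fun x => f (x + t k *: e)).
  exact: (measurableT_comp mf (measurable_translate _)).
have mq k : measurable_fun [set: 'rV[R]_d] (q k).
  by apply: measurable_funM => //; exact: measurable_funB.
have e1 : `|e| <= 1.
  rewrite /Num.norm/= mx_normrE; apply/bigmax_leP; split => // -[j l] _ /=.
  by rewrite mxE; case: (_ && _); rewrite ?normr1 ?normr0.
have M10 : 0 < M + 1 by rewrite addr_gt0.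
have fM k x : f (x + t k *: e) != 0 -> ball 0 (M + 1) x.
  move/hM; rewrite -!ball_normE /ball_/= !sub0r !normrN => hx.
  rewrite -(addrK (t k *: e) x) (le_lt_trans (ler_normB _ _))// ltr_leD//.
  by rewrite normrZ (ger0_norm (ltW (t0 k))) mulr_ile1// ltW.
have int0 k : (\int[mu]_x (q k x)%:E = 0)%E.
  have intf := integrable_compact_support cf sf.
  have intft : mu.-integrable setT (EFin \o (fun x => f (x + t k *: e))).
    have [C' _ hC'] := compact_support_bounded cf sf.
    apply: (integrable_bounded_support (C := C') M10 _ _ (fM k)) => [|x]; last exact: hC'.
    exact: mft.
  rewrite /q; under eq_integral do rewrite EFinM EFinB.
  rewrite integralZl//; last exact: integrableB.
  rewrite integralB_EFin//= (integral_translate (t k *: e) intf)/=.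
  by rewrite subee ?mule0// integrable_fin_num.
(* By the mean value theorem each quotient is a value of the partial derivative, which is bounded by
   [C]. *)
have qC k x : `|q k x| <= C.
  have [|s _ E] := MVT_segment (ltW (t0 k)) (fun s _ => is_derive_line i x s df).
    apply: continuous_subspaceT => s.
    apply: differentiable_continuous; apply/derivable1_diffP.
    by have [] := is_derive_line i x s df.
  rewrite scale0r add0r subr0 in E.
  by rewrite /q [x + _]addrC E mulrC mulfK ?gt_eqF.
have qM k x : q k x != 0 -> ball 0 (M + 1) x.
  move=> qx; have [fx|fx] := eqVneq (f x) 0; last first.
    by apply: le_ball (hM _ fx); rewrite lerDl.
  apply: (fM k); apply: contraNneq qx => fx'.
  by rewrite /q fx fx' subrr mulr0.
have [|||||_ _] := @dominated_convergence _ _ _ mu setT measurableT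
  (fun k => EFin \o q k) (EFin \o partial i f)
  (EFin \o (fun x => C * \1_(ball 0 (M + 1)) x)).
- by move=> k; exact/measurable_EFinP.
- by apply/measurable_EFinP; exact: continuous_measurable_rV.
- apply: aeW => x _ /=; apply: cvg_EFin; first exact: nearW.
  have ht : (forall k, t k != 0) /\ t k @[k --> \oo] --> 0.
    by split; [move=> k; rewrite gt_eqF|exact: cvg_harmonic].
  have /cvgr_dnbhsP /(_ t ht) : derivable f x e by exact: diff_derivable.
  rewrite -[lim _]/(partial i f x).
  rewrite [X in _ -> X @ _ --> _](_ : _ =
    fun k => (t k)^-1 *: ((f \o shift x) (t k *: e) - f x))//.
  by apply/funext => k /=; rewrite [_ *: _ + x]addrC.
- exact: integrable_ball_cst.
- by apply: aeW => x k _; exact: (ball_dominated x (qC k) (qM k)).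
by under eq_fun do rewrite int0; move/cvg_lim => <-//; rewrite lim_cst.
Qed.

End compact_support.

(** * Smooth functions and integration by parts *)

Section smooth_composition.
Context {R : realType} {d : nat}.
Implicit Types (F : R -> R) (f g h phi psi : 'rV[R]_d -> R).
Local Notation mu := (@lebesgue_rV R d).

Definition smooth_real F := forall n x, derivable (derive1n n F) x 1.

Lemma smooth_real_derive1 F : smooth_real F -> smooth_real (derive1 F).
Proof. by move=> sF n x; rewrite -derive1Sn; exact: sF. Qed.

(** In [foldr partial f s] the last index acts first, so one more inner derivative is appended at
    the end of [s]. *)
Lemma smooth_partial i f : smooth f -> smooth (partial i f).
Proof. by move=> sf s x; have := sf (rcons s i) x; rewrite foldr_rcons. Qed.

Lemma smooth_differentiable f x : smooth f -> differentiable f x.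
Proof. by move=> /(_ [::] x). Qed.

Lemma smooth_continuous f : smooth f -> continuous f.
Proof. by move=> sf x; exact/differentiable_continuous/smooth_differentiable. Qed.

Lemma partial_mul i f g x : differentiable f x -> differentiable g x ->
  partial i (f \* g) x = f x * partial i g x + g x * partial i f x.
Proof.
move=> df dg.
by rewrite /partial -[f \* g]/(f * g) deriveM//; exact: diff_derivable.
Qed.

Lemma partial_comp i F f x : derivable F (f x) 1 -> differentiable f x ->
  partial i (F \o f) x = derive1 F (f x) * partial i f x.
Proof.
move=> /derivable1_diffP dF df; rewrite /partial.
rewrite deriveE; last exact: differentiable_comp.
rewrite diff_comp//= deriv1E; last exact/derivable1_diffP.
by rewrite deriveE// mulrC.
Qed.

(* Each generator is differentiable and the class is stable under partial
   derivatives, which makes its members smooth without computing any iterated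
   derivative. *)
Inductive smooth_class : ('rV[R]_d -> R) -> Prop :=
| smooth_class_smooth f : smooth f -> smooth_class f
| smooth_class_add f g : smooth_class f -> smooth_class g ->
    smooth_class (f \+ g)
| smooth_class_mul f g : smooth_class f -> smooth_class g ->
    smooth_class (f \* g)
| smooth_class_comp F f : smooth_real F -> smooth f -> smooth_class (F \o f).

Lemma smooth_class_differentiable f x : smooth_class f -> differentiable f x.
Proof.
elim=> {f} [f|f g _ df _ dg|f g _ df _ dg|F f sF sf].
- exact: smooth_differentiable.
- exact: differentiableD.
- exact: differentiableM.
- apply: differentiable_comp; first exact: smooth_differentiable.
  exact/derivable1_diffP/(sF 0).
Qed.

Lemma smooth_class_partial i f : smooth_class f -> smooth_class (partial i f).
Proof.
elim=> {f} [f sf|f g sf ? sg ?|f g sf ? sg ?|F f sF sf].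
- by apply: smooth_class_smooth; exact: smooth_partial.
- rewrite (_ : partial _ _ = partial i f \+ partial i g).
    exact: smooth_class_add.
  apply/funext => x; rewrite /partial -[f \+ g]/(f + g) deriveD//.
    by apply: diff_derivable; exact: smooth_class_differentiable.
  by apply: diff_derivable; exact: smooth_class_differentiable.
- rewrite (_ : partial _ _ = (f \* partial i g) \+ (g \* partial i f)).
    by apply: smooth_class_add; exact: smooth_class_mul.
  by apply/funext => x; rewrite partial_mul//; exact: smooth_class_differentiable.
- rewrite (_ : partial _ _ = (derive1 F \o f) \* partial i f).
    apply: smooth_class_mul.
      by apply: smooth_class_comp => //; exact: smooth_real_derive1.
    by apply: smooth_class_smooth; exact: smooth_partial.
  apply/funext => x; rewrite partial_comp//; first exact: (sF 0).
  exact: smooth_differentiable.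
Qed.

Lemma smooth_comp F f : smooth_real F -> smooth f -> smooth (F \o f).
Proof.
move=> sF sf s x; apply: smooth_class_differentiable.
elim: s => [|i s IHs] /=; first exact: smooth_class_comp.
exact: smooth_class_partial.
Qed.

Lemma sub_compact_support f g :
  [set x | f x != 0] `<=` closure [set x | g x != 0] ->
  compact_support g -> compact_support f.
Proof.
move=> fg sg; apply: subclosed_compact sg _; first exact: closed_closure.
rewrite [X in _ `<=` X](closure_id _).1; last exact: closed_closure.
exact: closure_subset.
Qed.

Lemma test_function_comp (Omega : set 'rV[R]_d) F f :
  smooth_real F -> F 0 = 0 -> test_function Omega f ->
  test_function Omega (F \o f).
Proof.
move=> sF F0 [sf cf sfO].
have Ff : [set x | (F \o f) x != 0] `<=` [set x | f x != 0].
  by move=> x /=; apply: contraNneq => ->; rewrite F0.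
split; first exact: smooth_comp.
  exact: (sub_compact_support (subset_trans Ff (@subset_closure _ _)) cf).
exact: subset_trans (closure_subset Ff) sfO.
Qed.

Lemma test_function_partial (Omega : set 'rV[R]_d) i f :
  test_function Omega f -> test_function Omega (partial i f).
Proof.
move=> [sf cf sfO]; split; first exact: smooth_partial.
  exact: compact_support_partial.
apply: subset_trans sfO.
rewrite [X in _ `<=` X](closure_id _).1; last exact: closed_closure.
exact: (closure_subset (@partial_support _ _ i f)).
Qed.

(** The product [f \* psi] is smooth with compact support, so its partial derivative integrates to
    zero; the product rule splits that integral. *)
Lemma integral_by_parts_rV (Omega : set 'rV[R]_d) i f psi :
  smooth f -> test_function Omega psi ->
  \int[mu]_(x in Omega) (f x * partial i psi x) =
  - \int[mu]_(x in Omega) (partial i f x * psi x).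
Proof.
move=> sf tpsi; have [spsi cpsi psiO] := tpsi.
have [spsi' cpsi' psiO'] := test_function_partial i tpsi.
have cM (a b : 'rV[R]_d -> R) : continuous a -> continuous b -> continuous (a \* b).
  by move=> ca cb x; apply: continuousM; [exact: ca|exact: cb].
have supM (a b : 'rV[R]_d -> R) :
    [set x | (a \* b) x != 0] `<=` closure [set x | b x != 0].
  move=> x /= ab; apply: subset_closure => /=.
  by apply: contraNneq ab => ->; rewrite mulr0.
have cf := smooth_continuous sf.
have cf' := smooth_continuous (smooth_partial i sf).
have int1 : mu.-integrable setT (EFin \o (f \* partial i psi)).
  apply: integrable_compact_support; last exact: sub_compact_support cpsi'.
  by apply: cM => //; exact: smooth_continuous.
have int2 : mu.-integrable setT (EFin \o (partial i f \* psi)).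
  apply: integrable_compact_support; last exact: sub_compact_support cpsi.
  by apply: cM => //; exact: smooth_continuous.
have E : partial i (f \* psi) = (f \* partial i psi) \+ (partial i f \* psi).
  apply/funext => x; rewrite partial_mul; try exact: smooth_differentiable.
  by rewrite /= [psi x * _]mulrC.
(* The factor [b] vanishes outside [Omega], so integrals over [Omega] are integrals over the whole
   space. *)
have toT (a b : 'rV[R]_d -> R) : closure [set x | b x != 0] `<=` Omega ->
    \int[mu]_(x in Omega) (a x * b x) = \int[mu]_x (a x * b x).
  move=> bO; rewrite Rintegral_mkcond; congr Rintegral; apply/funext => x.
  rewrite patchE; case: ifPn => // /negP xO.
  have [->|bx] := eqVneq (b x) 0; first by rewrite mulr0.
  by exfalso; apply: xO; rewrite inE; apply: bO; exact: subset_closure.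
rewrite !toT//; apply/eqP; rewrite -addr_eq0 -RintegralD//.
have := @integral_partial_eq0 R d i (f \* psi) _ _ _.
rewrite /Rintegral E => -> //.
- move=> x; apply: smooth_class_differentiable.
  by apply: smooth_class_mul; exact: smooth_class_smooth.
- by move=> x; apply: continuousD; apply: cM => //; exact: smooth_continuous.
- exact: sub_compact_support cpsi.
Qed.

End smooth_composition.

(** * A smooth truncation *)

Section cutoff.
Context {R : realType}.
Implicit Types (x : R) (F G : R -> R).

(** For [n = 0] this is the classical flat function exp(-1/x). The negative powers of x arise from
    its derivatives. *)
Definition expinv n x : R := if 0 < x then x ^- n * expR (- x^-1) else 0.

Lemma expinv_ge0 n x : 0 <= expinv n x.
Proof.
rewrite /expinv; case: ifPn => // x0.
by rewrite mulr_ge0 ?expR_ge0// invr_ge0 exprn_ge0 ?ltW.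
Qed.

Lemma expinv_gt0 n x : 0 < x -> 0 < expinv n x.
Proof. by move=> x0; rewrite /expinv x0 mulr_gt0 ?expR_gt0// invr_gt0 exprn_gt0. Qed.

Lemma expinv_eq0 n x : x <= 0 -> expinv n x = 0.
Proof. by rewrite /expinv ltNge => ->. Qed.

(** The exponential dominates the single term y^n/n! of its series. *)
Lemma exprn_expRN_le n (y : R) : 0 <= y -> y ^+ n * expR (- y) <= n`!%:R.
Proof.
move=> y0; rewrite expRN ler_pdivrMr ?expR_gt0//.
case: n => [|n]; first by rewrite expr0 fact0 mul1r -expR0 ler_expR.
rewrite -ler_pdivrMl ?ltr0n ?fact_gt0// mulrC.
by apply: le_trans (expR_ge1Dxn n y0); rewrite lerDr.
Qed.

(** This is the preceding bound at y = 1/x with exponent n + k. Taking k = 2 gives differentiability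
    at 0, and k = 0 gives boundedness. *)
Lemma expinv_le n k x : expinv n x <= (n + k)`!%:R * `|x| ^+ k.
Proof.
rewrite /expinv; case: ifPn => [x0|_]; last by rewrite mulr_ge0 ?exprn_ge0.
rewrite (gtr0_norm x0) -ler_pdivrMr ?exprn_gt0//.
rewrite mulrAC -!exprVn -exprD.
by apply: exprn_expRN_le; rewrite invr_ge0 ltW.
Qed.

Lemma is_derive_expinv n x :
  is_derive x 1 (expinv n) (expinv n.+2 x - n%:R * expinv n.+1 x).
Proof.
have [x0|x0|->] := ltgtP x 0.
- apply: (@near_eq_is_derive _ _ _ (cst 0)).
    near=> y; rewrite expinv_eq0//; near: y.
    by near=> y; rewrite ltW//; near: y; exact: lt_nbhsl.
  rewrite !expinv_eq0 ?ltW// mulr0 subrr.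
  exact: is_derive_cst.
- apply: (@near_eq_is_derive R R R
      (fun y : R => (y^-1) ^+ n * expR (- y^-1))).
    near=> y; rewrite /expinv ifT ?exprVn//; near: y.
    exact: lt_nbhsr.
  (* For x > 0 the function is the composite of y^n exp(-y) with y = 1/x. *)
  have dV : is_derive x 1 (fun y : R => y^-1) (- x ^- 2).
    have := @is_deriveV R id x 1 1 (lt0r_neq0 x0) (is_derive_id _ _).
    by rewrite /GRing.scale/= mulr1.
  have dP : is_derive x^-1 1 (fun y : R => y ^+ n * expR (- y))
      (n%:R * x^-1 ^+ n.-1 * expR (- x^-1) - x^-1 ^+ n * expR (- x^-1)).
    have dX : is_derive x^-1 1 (fun y : R => y ^+ n) (n%:R * x^-1 ^+ n.-1).
      apply: DeriveDef; first exact: exprn_derivable.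
      by rewrite exp_derive /GRing.scale/= mulr1.
    have dE : is_derive x^-1 1 (fun y : R => expR (- y)) (- expR (- x^-1)).
      have := is_derive1_comp (is_derive_expR (- x^-1)) (is_deriveNid x^-1 1).
      by rewrite mulrN1.
    apply: (is_derive_eq (is_deriveM dX dE)).
    by rewrite /GRing.scale/= mulrN addrC [expR _ * _]mulrC.
  apply: (is_derive_eq (is_derive1_comp dP dV)).
  rewrite /expinv x0; case: n {dP} => [|n] /=; rewrite ?exprVn.
    by rewrite !mul0r; field; exact: lt0r_neq0.
  have key (p y a e : R) : (a * p * e - y * p * e) * - (y * y) =
      y * (y * (y * p)) * e - a * (y * (y * p) * e) by ring.
  by rewrite -!exprVn expr2 !exprS key.
- rewrite !expinv_eq0// mulr0 subrr.
  (* At 0 the quadratic bound on [expinv n] makes the difference quotient O(|h|). *)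
  have h : h^-1 *: (expinv n (h *: (1 : R) + 0) - expinv n 0) @[h --> 0^'] -->
      (0 : R).
    apply/cvgrPdist_le => e e0; near=> h.
    rewrite sub0r normrN [expinv n 0]expinv_eq0// subr0 addr0.
    rewrite /GRing.scale/= mulr1 normrM normfV (ger0_norm (expinv_ge0 _ _)).
    have h0 : h != 0 by near: h; exact: nbhs_dnbhs_neq.
    rewrite ler_pdivrMl ?normr_gt0//.
    apply: (le_trans (expinv_le n 2 h)).
    rewrite expr2 mulrCA ler_wpM2l// -ler_pdivlMl ?ltr0n ?fact_gt0//.
    near: h; apply: dnbhs0_le.
    by rewrite mulr_gt0// invr_gt0 ltr0n fact_gt0.
  by apply: DeriveDef; [apply/cvg_ex; exists 0|exact/cvg_lim].
Unshelve. all: by end_near. Qed.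

(** The linear combinations of the [expinv n] with affine arguments form a class that is closed
    under differentiation and has bounded members. Membership thus yields smoothness and bounds on
    every derivative at once. *)
Inductive expinv_class : (R -> R) -> Prop :=
| expinv_class_affine n a b : expinv_class (fun x => expinv n (a * x + b))
| expinv_class_scale c F : expinv_class F -> expinv_class (fun x => c * F x)
| expinv_class_add F G : expinv_class F -> expinv_class G ->
    expinv_class (F \+ G).

Lemma is_derive_expinv_affine n a b x :
  is_derive x 1 (fun x => expinv n (a * x + b))
    (a * expinv n.+2 (a * x + b) + (- a * n%:R) * expinv n.+1 (a * x + b)).
Proof.
have d : is_derive x 1 (fun x : R => a * x + b) a.
  by apply: is_derive_eq; rewrite /GRing.scale/= mulr1 addr0.
apply: (is_derive_eq (is_derive1_comp (is_derive_expinv n _) d)).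
by rewrite mulrC mulrBr mulNr mulNr mulrA.
Qed.

Lemma expinv_class_derive F : expinv_class F ->
  (forall x, derivable F x 1) /\ expinv_class (derive1 F).
Proof.
elim=> {F} [n a b|c F _ [dF cF]|F G _ [dF cF] _ [dG cG]].
- split=> [x|]; first by have [] := is_derive_expinv_affine n a b x.
  rewrite (_ : derive1 _ = (fun x => a * expinv n.+2 (a * x + b)) \+
    (fun x => (- a * n%:R) * expinv n.+1 (a * x + b))).
    by apply: expinv_class_add; apply: expinv_class_scale; exact: expinv_class_affine.
  apply/funext => x; rewrite derive1E.
  by have [_ ->] := is_derive_expinv_affine n a b x.
- split=> [x|]; first exact: (@derivableZ _ _ _ F c).
  rewrite (_ : derive1 _ = fun x => c * derive1 F x); first exact: expinv_class_scale.
  by apply/funext => x; rewrite !derive1E; exact: (@deriveZ _ _ _ F c).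
- split=> [x|]; first exact: derivableD.
  rewrite (_ : derive1 _ = derive1 F \+ derive1 G); first exact: expinv_class_add.
  by apply/funext => x; rewrite /= !derive1E; exact: deriveD.
Qed.

Lemma expinv_class_smooth F : expinv_class F -> smooth_real F.
Proof.
move=> cF n; apply: (expinv_class_derive _).1.
elim: n => [//|n IHn]; rewrite derive1nS; exact: (expinv_class_derive IHn).2.
Qed.

Lemma expinv_class_bounded F : expinv_class F ->
  exists2 C, 0 <= C & forall x, `|F x| <= C.
Proof.
elim=> {F} [n a b|c F _ [C C0 hC]|F G _ [C C0 hC] _ [D D0 hD]].
- exists n`!%:R => // x; rewrite ger0_norm ?expinv_ge0//.
  by have := expinv_le n 0 (a * x + b); rewrite addn0 expr0 mulr1.
- by exists (`|c| * C) => [|x]; [rewrite mulr_ge0|rewrite normrM ler_wpM2l].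
- exists (C + D) => [|x]; first by rewrite addr_ge0.
  by rewrite (le_trans (ler_normD _ _))// lerD.
Qed.

(** This is exp(-1/(x-1)) for x > 1, its odd reflection for x < -1, and 0 between. The factors [1]
    and [-1] are left unsimplified to match the constructors of [expinv_class]. *)
Definition cutoff : R -> R :=
  (fun x => expinv 0 (1 * x + -1)) \+
  (fun x => -1 * (fun x => expinv 0 (-1 * x + -1)) x).

Lemma expinv_class_cutoff : expinv_class cutoff.
Proof.
apply: expinv_class_add; first exact: expinv_class_affine.
exact/expinv_class_scale/expinv_class_affine.
Qed.

Lemma cutoff_eq0 x : `|x| <= 1 -> cutoff x = 0.
Proof.
rewrite ler_norml => /andP[h1 h2]; rewrite /cutoff/=.
by rewrite !expinv_eq0 ?mulr0 ?addr0//; lra.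
Qed.

Lemma cutoff_gt0 x : 1 < x -> 0 < cutoff x.
Proof.
move=> x1; rewrite /cutoff/= [expinv 0 (-1 * _ + _)]expinv_eq0; last by lra.
by rewrite mulr0 addr0 expinv_gt0//; lra.
Qed.

Lemma cutoff_lt0 x : x < -1 -> cutoff x < 0.
Proof.
move=> x1; rewrite /cutoff/= [expinv 0 (1 * _ + _)]expinv_eq0; last by lra.
by rewrite add0r mulN1r oppr_lt0 expinv_gt0//; lra.
Qed.

(** For n = 0 the negative term of the derivative of [expinv n] drops out, and the two inner and
    outer signs of the reflected half cancel. What remains is a sum of two values of [expinv 2]. *)
Lemma derive1_cutoff_ge0 x : 0 <= derive1 cutoff x.
Proof.
rewrite derive1E.
have [d1 e1] := is_derive_expinv_affine 0 1 (-1) x.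
have [d2 e2] := is_derive_expinv_affine 0 (-1) (-1) x.
rewrite deriveD//; last exact: (@derivableZ _ _ _ _ (-1)).
rewrite (@deriveZ _ _ _ (fun x => expinv 0 (-1 * x + -1)) (-1))//.
rewrite e1 e2 /GRing.scale/= !mulr0 !mul0r !addr0 mulN1r mulN1r opprK mul1r.
by rewrite addr_ge0 ?expinv_ge0.
Qed.

End cutoff.

(** * Convergence in L^2 *)

Section square_integral.
Context {disp : measure_display} {T : measurableType disp} {R : realType}.
Variables (mu : {measure set T -> \bar R}) (D : set T) (mD : measurable D).
Implicit Types (f g h : T -> R) (a b C : R).

Definition sqint f : \bar R := (\int[mu]_(x in D) ((f x) ^+ 2)%:E)%E.

Lemma sqint_ge0 f : (0 <= sqint f)%E.
Proof. by apply: integral_ge0 => x _; rewrite lee_fin sqr_ge0. Qed.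

Lemma measurable_sqr f : measurable_fun D f ->
  measurable_fun D (fun x => ((f x) ^+ 2)%:E).
Proof. by move=> mf; apply/measurable_EFinP; exact: measurable_funX. Qed.

Lemma le_integral_sqint f g h a b : measurable_fun D f -> measurable_fun D g ->
  measurable_fun D h -> 0 <= a -> 0 <= b ->
  (forall x, D x -> 0 <= f x <= a * g x ^+ 2 + b * h x ^+ 2) ->
  (\int[mu]_(x in D) (f x)%:E <= a%:E * sqint g + b%:E * sqint h)%E.
Proof.
move=> mf mg mh a0 b0 fgh.
have sq0 (k : T -> R) : forall x, D x -> (0 <= ((k x) ^+ 2)%:E :> \bar R)%E.
  by move=> x _; rewrite lee_fin sqr_ge0.
have msq c (k : T -> R) : measurable_fun D k ->
    measurable_fun D (fun x => c%:E * (k x ^+ 2)%:E)%E.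
  by move=> mk; apply: measurable_funeM; exact: measurable_sqr.
have csq0 c (k : T -> R) : 0 <= c ->
    forall x, D x -> (0 <= c%:E * ((k x) ^+ 2)%:E :> \bar R)%E.
  by move=> c0 x Dx; rewrite mule_ge0 ?lee_fin ?sqr_ge0.
rewrite -!ge0_integralZl_EFin//; try exact: measurable_sqr; try exact: sq0.
rewrite -ge0_integralD//; try exact: msq; try exact: csq0.
apply: ge0_le_integral => //.
- by move=> x Dx; rewrite lee_fin; have /andP[] := fgh x Dx.
- exact/measurable_EFinP.
- by apply: emeasurable_funD; exact: msq.
- by move=> x Dx; rewrite -!EFinM -EFinD lee_fin; have /andP[] := fgh x Dx.
Qed.

Lemma le_sqint f g C : measurable_fun D f -> measurable_fun D g ->
  (forall x, D x -> `|f x| <= C * `|g x|) -> (sqint f <= (C ^+ 2)%:E * sqint g)%E.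
Proof.
move=> mf mg fg.
have := @le_integral_sqint (fun x => f x ^+ 2) g g (C ^+ 2) 0.
rewrite mul0e adde0; apply; rewrite ?sqr_ge0//; first exact: measurable_funX.
move=> x Dx; rewrite sqr_ge0 mul0r addr0/=.
rewrite -[X in X <= _]real_normK ?num_real//.
rewrite -[X in _ * X]real_normK ?num_real// -exprMn.
by rewrite lerXn2r ?nnegrE ?fg// (le_trans _ (fg _ Dx)).
Qed.

(** A weighted Young inequality, from expanding the square of C|a| - |b|. With the weight free it
    takes the place of the Cauchy-Schwarz inequality below. *)
Lemma ler_normM_sqr a b C : 0 < C -> `|a * b| <= C * a ^+ 2 + C^-1 * b ^+ 2.
Proof.
move=> C0; rewrite normrM -(real_normK (num_real a)) -(real_normK (num_real b)).
have : 0 <= C^-1 * (C * `|a| - `|b|) ^+ 2 by rewrite mulr_ge0 ?sqr_ge0// invr_ge0 ltW.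
rewrite (_ : C^-1 * _ = C * `|a| ^+ 2 + C^-1 * `|b| ^+ 2 - 2 * (`|a| * `|b|)).
  by have := mulr_ge0 (normr_ge0 a) (normr_ge0 b); lra.
by field; rewrite gt_eqF.
Qed.

Lemma integrableM_sqint f g : measurable_fun D f -> measurable_fun D g ->
  (sqint f < +oo)%E -> (sqint g < +oo)%E -> mu.-integrable D (EFin \o (f \* g)).
Proof.
move=> mf mg fo go; have mfg := measurable_funM mf mg.
apply/integrableP; split; first exact/measurable_EFinP.
apply: (@le_lt_trans _ _ (1%:E * sqint f + 1%:E * sqint g)%E).
  apply: le_integral_sqint => //; first exact: measurableT_comp.
  by move=> x _; rewrite normr_ge0/= -[X in _ + X * _]invr1 ler_normM_sqr.
by rewrite !mul1e lte_add_pinfty.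
Qed.

Definition sqcvg0 (f : nat -> T -> R) :=
  forall e : R, 0 < e -> \forall k \near \oo, (sqint (f k) <= e%:E)%E.

Lemma le_sqcvg0 C (f g : nat -> T -> R) : (forall k, measurable_fun D (f k)) ->
  (forall k, measurable_fun D (g k)) ->
  (forall k x, D x -> `|f k x| <= C * `|g k x|) -> sqcvg0 g -> sqcvg0 f.
Proof.
move=> mf mg fg cg e e0.
(* The added 1 keeps the denominator positive when [C = 0]. *)
have C0 : 0 < C ^+ 2 + 1 by rewrite ltr_wpDl ?sqr_ge0.
have /cg : 0 < e / (C ^+ 2 + 1) by rewrite divr_gt0.
apply: filterS => k ge.
apply: (le_trans (le_sqint (mf k) (mg k) (fg k))).
apply: (@le_trans _ _ ((C ^+ 2)%:E * (e / (C ^+ 2 + 1))%:E)%E).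
  by rewrite lee_wpmul2l// lee_fin sqr_ge0.
by rewrite -EFinM lee_fin mulrCA ger_pMr// ler_pdivrMr// mul1r lerDl.
Qed.

Lemma cvg_integralM_sqint (f_ : nat -> T -> R) f g :
  (forall k, measurable_fun D (f_ k)) -> measurable_fun D f -> measurable_fun D g ->
  (forall k, (sqint (f_ k) < +oo)%E) -> (sqint f < +oo)%E -> (sqint g < +oo)%E ->
  sqcvg0 (fun k => f_ k \- f) ->
  \int[mu]_(x in D) (f_ k x * g x) @[k --> \oo] --> \int[mu]_(x in D) (f x * g x).
Proof.
move=> mf_ mf mg fo_ fo go cf; apply/cvgrPdist_le => e e0.
have [r r0 gr] : exists2 r : R, 0 <= r & sqint g = r%:E.
  have := sqint_ge0 g; case: (sqint g) go => // r _ r0; exists r => //.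
(* Young's inequality with weight [s] leaves r/s for the fixed factor [g], and this choice makes it
   at most e/2. The other half is s times the squared norm of [f_ k \- f], small for large k. *)
pose s := (2 * (r + 1)) / e.
have r1 : 0 < r + 1 by rewrite ltr_wpDl.
have s0 : 0 < s by rewrite divr_gt0// mulr_gt0.
have es0 : 0 < e / (2 * s) by rewrite divr_gt0// mulr_gt0.
near=> k.
have fk : (sqint (f_ k \- f)%R <= (e / (2 * s))%:E)%E by near: k; exact: cf.
rewrite distrC -RintegralB//; try exact: integrableM_sqint.
have mdf : measurable_fun D (f_ k \- f) by exact: measurable_funB.
rewrite (_ : (fun x => _) = (f_ k \- f) \* g); last first.
  by apply/funext => x /=; rewrite mulrBl.
have intd : mu.-integrable D (EFin \o ((f_ k \- f) \* g)).
  apply: integrableM_sqint => //.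
  by apply: le_lt_trans fk _; rewrite ltry.
apply: le_trans (le_normr_Rintegral mD intd) _.
rewrite -lee_fin fineK; last first.
  by apply: integrable_fin_num => //; exact: integrable_norm.
apply: (@le_trans _ _ (s%:E * sqint (f_ k \- f)%R + s^-1%:E * sqint g)%E).
  apply: le_integral_sqint => //; rewrite ?invr_ge0 ?ltW//.
    by apply: measurableT_comp => //; exact: measurable_funM.
  by move=> x _; rewrite normr_ge0 ler_normM_sqr.
apply: (@le_trans _ _ (s%:E * (e / (2 * s))%:E + s^-1%:E * r%:E)%E).
  by rewrite gr leeD2r// lee_wpmul2l// lee_fin ltW.
rewrite -!EFinM -EFinD lee_fin.
rewrite (_ : s * _ = e / 2); last by field; rewrite gt_eqF.
suff : s^-1 * r <= e / 2 by lra.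
rewrite /s invf_div mulrAC ler_pdivrMr ?mulr_gt0//.
by have := mulr_ge0 (ltW e0) r0; nra.
Unshelve. all: by end_near. Qed.

Definition tail f (M : nat) : T -> R :=
  fun x => if M%:R < `|f x| then f x else 0.

Lemma measurable_tail f M : measurable_fun D f -> measurable_fun D (tail f M).
Proof.
move=> mf.
apply: (@measurableT_comp _ _ _ _ _ _ (fun y : R => if M%:R < `|y| then y else 0)) mf.
apply: measurable_fun_ifT => //.
by apply: measurable_fun_ltr => //; exact: measurableT_comp.
Qed.

(** At each point the tail is zero once M reaches |f x|, and its square is dominated by the
    integrable f^2. *)
Lemma sqint_tail f : measurable_fun D f -> (sqint f < +oo)%E ->
  forall e : R, 0 < e -> exists M : nat, (sqint (tail f M) <= e%:E)%E.
Proof.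
move=> mf fo e e0.
have intf : mu.-integrable D (fun x => ((f x) ^+ 2)%:E).
  apply/integrableP; split; first exact: measurable_sqr.
  by under eq_integral do rewrite gee0_abs ?lee_fin ?sqr_ge0//.
have [|||||_ _] := @dominated_convergence _ _ _ mu D mD
  (fun M x => ((tail f M x) ^+ 2)%:E) (cst 0%E) (fun x => ((f x) ^+ 2)%:E).
- by move=> M; apply: measurable_sqr; exact: measurable_tail.
- exact: measurable_cst.
- apply: aeW => x _; apply: cvg_near_cst; near=> M.
  rewrite /tail ltNge (_ : `|f x| <= M%:R) ?expr0n//.
  near: M; exact: nbhs_infty_ger.
- exact: intf.
- apply: aeW => x M _; rewrite /= lee_fin ger0_norm ?sqr_ge0// /tail.
  by case: ifP => // _; rewrite expr0n sqr_ge0.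
rewrite integral0 => /fine_cvgP [fn /cvgrPdist_le /(_ e e0) h].
near \oo => M; exists M.
have fM : sqint (tail f M) \is a fin_num by near: M.
have : `|0 - fine (sqint (tail f M))| <= e by near: M.
rewrite sub0r normrN ger0_norm ?fine_ge0 ?sqint_ge0//.
by rewrite -lee_fin fineK.
Unshelve. all: by end_near. Qed.

(* Where [|g| <= M] the difference [F (f_ k) - F f] is controlled by the L^2
   convergence of [f_]; the rest is the L^2 tail of [g], so no almost everywhere
   convergent subsequence is needed. *)
Lemma sqcvg0_lipschitzM (L K : R) (F : R -> R) (f_ g_ : nat -> T -> R) f g :
  measurable_fun setT F ->
  (forall x, `|F x| <= K) -> (forall x y, `|F x - F y| <= L * `|x - y|) ->
  (forall k, measurable_fun D (f_ k)) -> (forall k, measurable_fun D (g_ k)) ->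
  measurable_fun D f -> measurable_fun D g -> (sqint g < +oo)%E ->
  sqcvg0 (fun k => f_ k \- f) -> sqcvg0 (fun k => g_ k \- g) ->
  sqcvg0 (fun k => ((F \o f_ k) \* g_ k) \- ((F \o f) \* g)).
Proof.
move=> mF FK FL mf_ mg_ mf mg go cf cg e e0.
have K0 : 0 <= K by apply: le_trans (FK 0).
have sqr_le (a b : R) : `|a| <= b -> a ^+ 2 <= b ^+ 2.
  move=> ab; rewrite -[leLHS]real_normK ?num_real// lerXn2r ?nnegrE//.
  exact: le_trans ab.
have le_scaled (a c : R) (x : \bar R) : 0 <= a -> 0 < c ->
    (x <= (c / (a + 1))%:E)%E -> (a%:E * x <= c%:E)%E.
  move=> a0 c0 xc; have a1 : 0 < a + 1 by rewrite ltr_wpDl.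
  apply: (@le_trans _ _ (a%:E * (c / (a + 1))%:E)%E).
    by rewrite lee_wpmul2l// lee_fin.
  by rewrite -EFinM lee_fin mulrCA ger_pMr// ler_pdivrMr// mul1r lerDl.
have K2 : 0 <= 4 * K ^+ 2 by rewrite mulr_ge0 ?sqr_ge0.
have K3 : 0 <= 2 * K ^+ 2 by rewrite mulr_ge0 ?sqr_ge0.
have e2 : 0 < e / 2 by rewrite divr_gt0.
have e8 : 0 < e / 8 by rewrite divr_gt0.
have pos1 (a c : R) : 0 <= a -> 0 < c -> 0 < c / (a + 1).
  by move=> a0 c0; rewrite divr_gt0// ltr_wpDl.
(* The level [M] is fixed before [k], so that the Lipschitz term, whose constant involves [M], can
   be made small afterwards. *)
have [M gM] := sqint_tail mg go (pos1 _ _ K2 e8).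
have LM : 0 <= (L * M%:R) ^+ 2 by rewrite sqr_ge0.
near=> k.
have fk : (sqint (f_ k \- f)%R <= (e / 8 / ((L * M%:R) ^+ 2 + 1))%:E)%E.
  by near: k; apply: cf; exact: pos1.
have gk : (sqint (g_ k \- g)%R <= (e / 2 / (2 * K ^+ 2 + 1))%:E)%E.
  by near: k; apply: cg; exact: pos1.
(* The difference splits as F(f_k)(g_k - g) + h. In [h] the Lipschitz bound is used where |g| is at
   most M, and the crude bound 2K where |g| exceeds M. *)
pose h x := (F (f_ k x) - F (f x)) * g x.
have mFk : measurable_fun D (F \o f_ k) by exact: measurableT_comp.
have mFf : measurable_fun D (F \o f) by exact: measurableT_comp.
have mh : measurable_fun D h by exact: (measurable_funM (measurable_funB mFk mFf) mg).
have hk : (sqint h <= (e / 4)%:E)%E.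
  apply: (@le_trans _ _ (((L * M%:R) ^+ 2)%:E * sqint (f_ k \- f)%R
      + (4 * K ^+ 2)%:E * sqint (tail g M))%E).
    apply: le_integral_sqint => //.
    - exact: measurable_funX.
    - exact: measurable_funB.
    - exact: measurable_tail.
    move=> x Dx; rewrite sqr_ge0/= /tail; case: ltP => gx.
      have F2 : `|F (f_ k x) - F (f x)| <= 2 * K.
        by rewrite (le_trans (ler_normB _ _))// mulr2n mulrDl mul1r lerD.
      apply: (@le_trans _ _ (4 * K ^+ 2 * g x ^+ 2)); last by rewrite lerDr mulr_ge0 ?sqr_ge0.
      rewrite /h exprMn ler_wpM2r ?sqr_ge0//.
      by rewrite (_ : 4 * _ = (2 * K) ^+ 2) ?sqr_le//; ring.
    rewrite expr0n mulr0 addr0 /h/=.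
    rewrite (_ : _ * _ ^+ 2 = (L * `|f_ k x - f x| * M%:R) ^+ 2); last first.
      by rewrite !exprMn real_normK ?num_real//; ring.
    by apply: sqr_le; rewrite normrM ler_pM.
  rewrite (_ : e / 4 = e / 8 + e / 8); last by field.
  by rewrite EFinD leeD// le_scaled.
apply: (@le_trans _ _ ((2 * K ^+ 2)%:E * sqint (g_ k \- g)%R + 2%:E * sqint h)%E).
  apply: le_integral_sqint => //.
  - exact: (measurable_funX _ (measurable_funB (measurable_funM mFk (mg_ k))
      (measurable_funM mFf mg))).
  - exact: measurable_funB.
  move=> x Dx; rewrite sqr_ge0/=.
  rewrite (_ : F (f_ k x) * g_ k x - F (f x) * g x =
     F (f_ k x) * (g_ k x - g x) + h x); last by rewrite /h; ring.
  have : (F (f_ k x) * (g_ k x - g x)) ^+ 2 <= K ^+ 2 * (g_ k x - g x) ^+ 2.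
    by rewrite exprMn ler_wpM2r ?sqr_ge0// sqr_le.
  move: (F (f_ k x) * _) (h x) => p q; have := sqr_ge0 (p - q); nra.
rewrite (_ : e%:E = (e / 2)%:E + 2%:E * (e / 4)%:E)%E; last first.
  by rewrite -EFinM -EFinD; congr EFin; field.
apply: leeD; [exact: le_scaled|exact: lee_wpmul2l].
Unshelve. all: by end_near. Qed.

End square_integral.

(** * Composition in H^1_0 *)

Lemma lipschitz_derive1_bounded {R : realType} (F : R -> R) (K : R) :
  (forall x, derivable F x 1) -> (forall x, `|derive1 F x| <= K) ->
  forall x y, `|F x - F y| <= K * `|x - y|.
Proof.
move=> dF FK x y.
wlog xy : x y / x <= y.
  by move=> h; have [/h//|/ltW/h] := leP x y; rewrite distrC [`|y - x|]distrC.
have dF' (t : R) : is_derive t 1 F (derive1 F t) by rewrite derive1E; exact: derivableP.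
have [|c _ E] := MVT_segment xy (fun t _ => dF' t).
  apply: continuous_subspaceT => t.
  by apply: differentiable_continuous; exact/derivable1_diffP.
by rewrite distrC [`|x - y|]distrC E normrM ler_wpM2r.
Qed.

Section sobolev.
Context {R : realType} {d : nat} (Omega : set 'rV[R]_d) (oO : open Omega).
Implicit Types (f u psi : 'rV[R]_d -> R).
Local Notation mu := (@lebesgue_rV R d).
Local Notation sq := (sqint mu Omega).

Let mO : measurable Omega := open_measurable_rV oO.

Lemma Lp_norm2_sqint f : ((Lp_norm Omega 2%:E f) `^ 2 = sq f)%E.
Proof.
rewrite /Lp_norm poweR_Lnorm// /sqint [RHS]integral_mkcond.
apply: eq_integral => x _ /=; rewrite !patchE.
case: ifPn => _; last by rewrite normr0 powR0.
by rewrite powR_mulrn// real_normK ?num_real.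
Qed.

Lemma L2P f : L2 Omega f <-> measurable_fun Omega f /\ (sq f < +oo)%E.
Proof.
rewrite /L2 -Lp_norm2_sqint; split=> -[mf fo]; split => //.
  exact: poweR_lty.
by apply: lty_poweRy fo.
Qed.

Lemma cvg_Lp_norm2P (f : nat -> 'rV[R]_d -> R) :
  Lp_norm Omega 2%:E (f k) @[k --> \oo] --> 0%E <-> sqcvg0 mu Omega f.
Proof.
split.
  move=> /fine_cvgP [fn /cvgrPdist_le h] e e0.
  have se0 : 0 < Num.sqrt e by rewrite sqrtr_gt0.
  near=> k; rewrite -Lp_norm2_sqint.
  have fk : Lp_norm Omega 2%:E (f k) \is a fin_num by near: k.
  have : `|0 - fine (Lp_norm Omega 2%:E (f k))| <= Num.sqrt e by near: k; exact: h.
  have N0 : (0 <= Lp_norm Omega 2%:E (f k))%E by exact: Lnorm_ge0.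
  rewrite sub0r normrN ger0_norm ?fine_ge0// => Ne.
  rewrite -(fineK fk) poweR_EFin lee_fin powR_mulrn ?fine_ge0//.
  rewrite -[leRHS](sqr_sqrtr (ltW e0)) lerXn2r ?nnegrE ?fine_ge0 ?sqrtr_ge0//.
move=> h.
have key (e : R) k : 0 < e -> (sq (f k) <= (e ^+ 2)%:E)%E ->
    Lp_norm Omega 2%:E (f k) \is a fin_num /\ fine (Lp_norm Omega 2%:E (f k)) <= e.
  move=> e0; rewrite -Lp_norm2_sqint.
  have : (0 <= Lp_norm Omega 2%:E (f k))%E by exact: Lnorm_ge0.
  case: (Lp_norm _ _ _) => [r|_|//].
    rewrite poweR_EFin !lee_fin => r0; rewrite powR_mulrn// => re; split => //=.
    by move: re; rewrite ler_pXn2r// nnegrE ltW.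
  by rewrite poweRyr// leye_eq.
apply/fine_cvgP; split.
  have := h 1 ltr01; apply: filterS => k; rewrite -[1]/(1%R) => hk.
  by apply: (key 1 k ltr01 _).1; rewrite expr1n.
apply/cvgrPdist_le => e e0.
have := h (e ^+ 2) (exprn_gt0 2 e0); apply: filterS => k hk.
rewrite sub0r normrN ger0_norm; first exact: (key e k e0 hk).2.
by rewrite fine_ge0//; exact: Lnorm_ge0.
Unshelve. all: by end_near. Qed.

Lemma measurable_smooth f : smooth f -> measurable_fun Omega f.
Proof.
move=> sf; apply: measurable_funTS.
exact: (continuous_measurable_rV (smooth_continuous sf)).
Qed.

Lemma sqint_test_function psi : test_function Omega psi -> (sq psi < +oo)%E.
Proof.
move=> [sp cp _]; have cpsi := smooth_continuous sp.
apply: integrable_lty => //.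
apply: (integrableS measurableT mO) => //.
apply: integrable_compact_support.
  by move=> x; apply: (@continuousM _ _ psi psi); exact: cpsi.
apply: sub_compact_support cp => x /= px; apply: subset_closure.
by apply: contraNneq px => ->; rewrite expr0n.
Qed.

(** The bound [K] makes [F] Lipschitz, so [F \o phi k] tends to [F \o u] in L^2. The bound [L] makes
    the derivative of [F] Lipschitz as well as bounded, which gives convergence of the gradients. *)
Lemma H10_comp (F : R -> R) (K L : R) u G :
  smooth_real F -> F 0 = 0 -> (forall x, `|derive1 F x| <= K) ->
  (forall x, `|derive1 (derive1 F) x| <= L) -> H10 Omega u G ->
  H10 Omega (F \o u) (fun i => (derive1 F \o u) \* G i).
Proof.
move=> sF F0 FK F'L [[/L2P[mu_ su] L2G wG] [phi [tphi cphi cphi']]].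
have sF' := smooth_real_derive1 sF.
have dF (x : R) : derivable F x 1 by exact: (sF 0).
have dF' (x : R) : derivable (derive1 F) x 1 by exact: (sF' 0).
have F_lip := lipschitz_derive1_bounded dF FK.
have F'_lip := lipschitz_derive1_bounded dF' F'L.
have mR (H : R -> R) : (forall x, derivable H x 1) -> measurable_fun setT H.
  move=> dH; apply: continuous_measurable_fun => x.
  by apply: differentiable_continuous; exact/derivable1_diffP.
have mF := mR _ dF; have mF' := mR _ dF'.
have mG i : measurable_fun Omega (G i) by have /L2P[] := L2G i.
have sG i : (sq (G i) < +oo)%E by have /L2P[] := L2G i.
have mFu : measurable_fun Omega (F \o u) by exact: measurableT_comp.
have mF'G i : measurable_fun Omega ((derive1 F \o u) \* G i).
  by apply: measurable_funM => //; exact: measurableT_comp.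
have scale_lty (C : R) (x : \bar R) : (x < +oo)%E -> ((C ^+ 2)%:E * x < +oo)%E.
  by move=> xo; apply: lte_mul_pinfty => //; rewrite lee_fin sqr_ge0.
have sFu : (sq (F \o u) < +oo)%E.
  apply: le_lt_trans (scale_lty K _ su); apply: le_sqint => // x _.
  (* As [F 0 = 0], the Lipschitz bound reads |F(u)| <= K |u|. *)
  by have := F_lip (u x) 0; rewrite F0 !subr0.
have sF'G i : (sq ((derive1 F \o u) \* G i)%R < +oo)%E.
  apply: le_lt_trans (scale_lty K _ (sG i)); apply: le_sqint => // x _.
  by rewrite /= normrM ler_wpM2r // FK.
have tF k := test_function_comp sF F0 (tphi k).
have tF' k i := test_function_partial i (tF k).
have mtest psi : test_function Omega psi -> measurable_fun Omega psi.
  by move=> [sp _ _]; exact: measurable_smooth.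
have cF : sqcvg0 mu Omega (fun k => (F \o phi k) \- (F \o u)).
  apply: (le_sqcvg0 mO (C := K) _ _ _ ((cvg_Lp_norm2P _).1 cphi)) => [k|k|k x _].
  - by apply: measurable_funB => //; exact: mtest.
  - by apply: measurable_funB => //; exact: mtest.
  - exact: F_lip.
have pF k i : partial i (F \o phi k) = (derive1 F \o phi k) \* partial i (phi k).
  apply/funext => x; apply: partial_comp; first exact: (sF 0).
  by have [sp _ _] := tphi k; exact: smooth_differentiable.
have cF' i : sqcvg0 mu Omega
    (fun k => partial i (F \o phi k) \- ((derive1 F \o u) \* G i)).
  under eq_fun do rewrite pF.
  apply: (sqcvg0_lipschitzM mO mF' FK F'_lip) => //.
  - by move=> k; exact: mtest.
  - by move=> k; apply: mtest; exact: test_function_partial.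
  - exact/cvg_Lp_norm2P.
  - exact/cvg_Lp_norm2P.
split; last first.
  exists (fun k => F \o phi k); split => //.
    exact/cvg_Lp_norm2P.
  by move=> i; exact/cvg_Lp_norm2P.
split; [exact/L2P|by move=> i; apply/L2P|] => i psi tpsi.
have tpsi' := test_function_partial i tpsi.
(* Both sides of the weak gradient identity are limits of the corresponding integrals for
   [F \o phi k], which agree by classical integration by parts. *)
have lim1 := cvg_integralM_sqint mO (fun k => mtest _ (tF k)) mFu (mtest _ tpsi')
  (fun k => sqint_test_function (tF k)) sFu (sqint_test_function tpsi') cF.
have lim2 := cvg_integralM_sqint mO (fun k => mtest _ (tF' k i)) (mF'G i)
  (mtest _ tpsi) (fun k => sqint_test_function (tF' k i)) (sF'G i)
  (sqint_test_function tpsi) (cF' i).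
apply: (cvg_unique _ lim1) => //.
rewrite /= [X in X @ _ --> _](_ : _ = fun k =>
  - \int[mu]_(x in Omega) (partial i (F \o phi k) x * psi x)).
  exact: cvgN lim2.
apply/funext => k; apply: integral_by_parts_rV => //.
by have [] := tF k.
Qed.

End sobolev.

(** * Maximum principles *)

Section weak_maximum_principle.
Context {R : realType} {d : nat} (Omega : set 'rV[R]_d) (oO : open Omega).
Implicit Types (f u w : 'rV[R]_d -> R).
Local Notation mu := (@lebesgue_rV R d).

Lemma Lp_normy_le1P f : (Lp_norm Omega +oo%E f <= 1)%E <->
  {ae mu, forall x, Omega x -> `|f x| <= 1}.
Proof.
(* When the whole space has measure zero the L^oo norm is 0 by convention, and every property holds
   almost everywhere. *)
rewrite /Lp_norm unlock; case: ifPn => [_|mu0]; last first.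
  split=> [_|_]; last by rewrite lee_fin.
  exists setT; split => //; apply/eqP.
  by rewrite eq_le measure_ge0 andbT leNgt.
split=> [/ess_supP|h].
  apply: filterS => x /=; rewrite lee_fin patchE => + Ox.
  by rewrite mem_set.
apply/ess_supP; apply: filterS h => x /= h; rewrite lee_fin patchE.
by case: ifPn => [|_]; [rewrite inE => /h|rewrite normr0].
Qed.

(** The sign conditions concern only the set where |u| > 1: elsewhere the test function
    [cutoff \o u] vanishes. *)
Lemma weak_solution_le1 (kappa : R) w u f :
  weak_solution Omega kappa w u f ->
  {ae mu, forall x, Omega x -> 1 < u x -> f x < w x} ->
  {ae mu, forall x, Omega x -> u x < -1 -> w x < f x} ->
  {ae mu, forall x, Omega x -> `|u x| <= 1}.
Proof.
move=> [G HuG weak] up down.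
have mO := open_measurable_rV oO.
have [_ cF'] := expinv_class_derive (@expinv_class_cutoff R).
have [_ cF''] := expinv_class_derive cF'.
have [K _ hK] := expinv_class_bounded cF'.
have [L _ hL] := expinv_class_bounded cF''.
have F0 : cutoff (0 : R) = 0 by rewrite cutoff_eq0// normr0.
have Hv := H10_comp oO (expinv_class_smooth (@expinv_class_cutoff R)) F0 hK hL HuG.
have [int1 int2 E] := weak _ _ Hv.
set v := cutoff \o u in Hv int1 int2 E.
pose p := (w \* v) \- (f \* v).
have intp : mu.-integrable Omega (EFin \o p).
  by apply: eq_integrable (integrableB mO int1 int2).
have mp : measurable_fun Omega (EFin \o p) by exact: measurable_int intp.
have p_le0 : \int[mu]_(x in Omega) p x <= 0.
  (* By the equation, the integral of [p] is minus kappa^2 times a sum of integrals of cutoff'(u)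
     G_i^2. *)
  rewrite RintegralB// -E opprD addrA subrr add0r oppr_le0 mulr_ge0 ?sqr_ge0//.
  apply: sumr_ge0 => i _; apply: Rintegral_ge0 => x _ /=.
  by rewrite mulrCA mulr_ge0 ?derive1_cutoff_ge0// -expr2 sqr_ge0.
have p_ge0 : {ae mu, forall x, Omega x -> 0 <= p x}.
  near=> x => Ox; rewrite /p/= /v/= -mulrBl.
  have ux : 1 < u x -> f x < w x by move: Ox; near: x.
  have dx : u x < -1 -> w x < f x by move: Ox; near: x.
  have [u1|] := ltP 1 (u x).
    by rewrite mulr_ge0// ?subr_ge0 ltW ?ux// cutoff_gt0.
  have [u1|u1 u2] := ltP (u x) (-1).
    by rewrite mulr_le0// ?subr_le0 ltW ?dx// cutoff_lt0.
  by rewrite cutoff_eq0 ?mulr0// ler_norml u1.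
(* Since [p] is nonnegative almost everywhere with nonpositive integral, it vanishes almost
   everywhere. *)
have : (\int[mu]_(x in Omega) `|(EFin \o p) x| = 0)%E.
  apply/eqP; rewrite eq_le integral_ge0 ?andbT; last by move=> x _; exact: abse_ge0.
  rewrite (_ : (\int[mu]_(x in Omega) _ = \int[mu]_(x in Omega) (p x)%:E)%E).
    by rewrite -(fineK (integrable_fin_num mO intp)) lee_fin.
  apply: ae_eq_integral => //; first exact: measurableT_comp.
  by apply: filterS p_ge0 => x h /h {}h /=; rewrite ger0_norm.
move/(ae_eq_integral_abs mu mO mp) => p0.
near=> x => Ox.
have ux : 1 < u x -> f x < w x by move: Ox; near: x.
have dx : u x < -1 -> w x < f x by move: Ox; near: x.
have : p x = 0.
  have h : Omega x -> (EFin \o p) x = cst 0%E x by near: x.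
  by have [] := h Ox.
(* One of the factors w - f and cutoff(u) is zero, whereas both are nonzero where |u| > 1. *)
rewrite /p/= -mulrBl => /eqP; rewrite mulf_eq0 => p0x.
rewrite ler_norml; apply/andP; split; rewrite leNgt; apply/negP => u1.
  move: p0x; rewrite lt_eqF ?subr_lt0 ?dx//= lt_eqF//.
  exact: cutoff_lt0.
move: p0x; rewrite gt_eqF ?subr_gt0 ?ux//= gt_eqF//.
exact: cutoff_gt0.
Unshelve. all: by end_near. Qed.

End weak_maximum_principle.

(** * Signs and partial sums of the quadrature weights *)

Section quadrature_weights.
Context {R : realType} (alpha : R) (halpha : 0 < alpha < 1).

Lemma omega0 : omega alpha 0 = 1.
Proof. by rewrite /omega big_ord0 expr0 fact0 invr1 !mulr1. Qed.

Lemma omegaS j : omega alpha j.+1 = (j%:R - alpha) / j.+1%:R * omega alpha j.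
Proof.
rewrite /omega exprS big_ord_recr/= factS natrM invfM.
by ring.
Qed.

(** The two claims support each other: if omega_(m+1) is -alpha/(m+1) times the partial sum s_m,
    then s_(m+1) = s_m (1 - alpha/(m+1)), which stays positive because alpha < 1. *)
Lemma sum_omega_gt0 m :
  0 < \sum_(k < m.+1) omega alpha k /\
  omega alpha m.+1 = - (alpha / m.+1%:R * \sum_(k < m.+1) omega alpha k).
Proof.
have /andP[a0 a1] := halpha.
elim: m => [|m [IH1 IH2]].
  rewrite big_ord1 omega0 omegaS omega0; split => //.
  by rewrite sub0r !mulr1 mulNr.
rewrite big_ord_recr/=.
set s := \sum_(k < m.+1) _ in IH1 IH2 *.
have m1 : 1 <= m.+1%:R :> R by rewrite ler1n.
have E : s + omega alpha m.+1 = s * (1 - alpha / m.+1%:R).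
  by rewrite IH2; ring.
split.
  rewrite E mulr_gt0// subr_gt0 ltr_pdivrMr ?ltr0n// mul1r.
  exact: lt_le_trans a1 m1.
rewrite omegaS E IH2; field.
by rewrite !gt_eqF// ltr0n.
Qed.

Lemma omega_le0 j : omega alpha j.+1 <= 0.
Proof.
have [s0 ->] := sum_omega_gt0 j; have /andP[a0 _] := halpha.
by rewrite oppr_le0 mulr_ge0 ?divr_ge0// ltW.
Qed.

End quadrature_weights.

(** * Extrapolation bound and induction over the time steps *)

Section schemes.
Context {R : realType} {d : nat}.
Variables (alpha tau : R) (halpha : 0 < alpha < 1) (htau : 0 < tau).
Implicit Types (u : nat -> 'rV[R]_d -> R).

Lemma dbarE u n x :
  dbar alpha tau u n x = tau `^ (- alpha) * (u n x - extrap alpha tau u n x).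
Proof.
rewrite /extrap subKr mulrA -powRD ?addNr ?powRr0 ?mul1r//.
by rewrite (gt_eqF htau) implybT.
Qed.

(** The term [j = n] has weight omega_0 = 1 and cancels [u n], which leaves only earlier
    iterates. *)
Lemma extrapE u n x : (0 < n)%N -> extrap alpha tau u n x =
  u 0%N x - \sum_(1 <= j < n) omega alpha (n - j) * (u j x - u 0%N x).
Proof.
move=> n0; rewrite /extrap /dbar mulrA -powRD; last by rewrite (gt_eqF htau) implybT.
rewrite subrr powRr0 mul1r big_nat_recr//= subnn omega0 mul1r.
by ring.
Qed.

(** The extrapolation is a convex combination: [u j] with 1 <= j < n has weight -omega_(n-j), and
    [u 0] has the remaining weight, which is the partial sum omega_0 + ... + omega_(n-1). *)
Lemma normr_extrap_le1 u n x : (0 < n)%N ->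
  (forall j, (j < n)%N -> `|u j x| <= 1) -> `|extrap alpha tau u n x| <= 1.
Proof.
move=> n0 hu; rewrite extrapE//.
pose s := \sum_(1 <= j < n) omega alpha (n - j).
have s1 : 0 <= 1 + s.
  (* Reversing the order of summation turns 1 + s into a partial sum of the weights. *)
  rewrite /s big_nat_rev/= (eq_big_nat _ _ (F2 := omega alpha)); last first.
    by move=> i /andP[i1 i2]; rewrite add1n subSS subKn// ltnW.
  case: n n0 {hu s} => // n _.
  have [s0 _] := sum_omega_gt0 halpha n.
  by rewrite -[X in X + _](omega0 alpha) -big_ltn// big_mkord ltW.
rewrite (_ : _ - _ = (1 + s) * u 0%N x + \sum_(1 <= j < n) - omega alpha (n - j) * u j x).
  apply: (le_trans (ler_normD _ _)).
  rewrite -[leRHS](_ : (1 + s) + \sum_(1 <= j < n) - omega alpha (n - j) = _); last first.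
    by rewrite sumrN addrK.
  rewrite lerD//; first by rewrite normrM (ger0_norm s1) ler_piMr// hu.
  apply: (le_trans (ler_norm_sum _ _ _)).
  rewrite big_nat_cond [leRHS]big_nat_cond; apply: ler_sum => j /andP[/andP[j1 jn] _].
  have oj : 0 <= - omega alpha (n - j).
    by rewrite oppr_ge0 -(prednK (_ : 0 < n - j)%N) ?subn_gt0// omega_le0.
  by rewrite normrM (ger0_norm oj) ler_piMr// hu.
rewrite mulrDl mul1r -addrA; congr (_ + _).
rewrite /s mulr_suml -sumrN -big_split/=; apply: eq_bigr => j _.
by ring.
Qed.

(** The part common to both schemes: what is left for each is a pointwise inequality between real
    numbers. The induction is strong because the extrapolation involves the whole history. *)
Lemma discrete_maximum_principle (Omega : set 'rV[R]_d) (kappa : R) (N : nat) u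
    (f : nat -> 'rV[R]_d -> R) :
  open Omega ->
  (forall n, (1 <= n <= N)%N ->
    weak_solution Omega kappa (dbar alpha tau u n) (u n) (f n)) ->
  (forall n x, `|extrap alpha tau u n x| <= 1 ->
    (1 < u n x -> f n x < dbar alpha tau u n x) /\
    (u n x < -1 -> dbar alpha tau u n x < f n x)) ->
  (Lp_norm Omega +oo%E (u 0%N) <= 1)%E ->
  forall n, (1 <= n <= N)%N -> (Lp_norm Omega +oo%E (u n) <= 1)%E.
Proof.
move=> oO sol hf hu0.
suff H n : (n <= N)%N -> (Lp_norm Omega +oo%E (u n) <= 1)%E.
  by move=> n /andP[_ nN]; exact: H.
elim/ltn_ind: n => -[//|n] IH nN.
apply/Lp_normy_le1P.
have hg : {ae (@lebesgue_rV R d), forall x, Omega x ->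
    `|extrap alpha tau u n.+1 x| <= 1}.
  (* The exceptional null sets of the earlier iterates are merged by a countable union; indices
     beyond [n] contribute a vacuous claim. *)
  have : {ae (@lebesgue_rV R d), forall x, forall j, Omega x -> (j < n.+1)%N -> `|u j x| <= 1}.
    apply: ae_foralln => j.
    have [jn|jn] := ltnP j n.+1; last by apply: aeW => x _.
    have /Lp_normy_le1P := IH j jn (leq_trans (ltnW jn) nN).
    by apply: filterS => x h /h.
  by apply: filterS => x h Ox; apply: normr_extrap_le1 => // j jn; exact: h.
apply: (weak_solution_le1 oO (sol n.+1 _)); first by rewrite nN.
  by apply: filterS hg => x h /h /hf[].
by apply: filterS hg => x h /h /hf[].
Qed.

End schemes.

Theorem theorem3p3 (R : realType) (d : nat) (Omega : set 'rV[R]_d)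
    (alpha kappa T S : R) (N : nat)
    (hd : (1 <= d <= 3)%N) (hOmega : bounded_smooth_domain Omega)
    (halpha : 0 < alpha < 1) (hkappa : 0 < kappa) (hT : 0 < T)
    (hN : (0 < N)%N) (hS : 0 < S) :
  let tau := T / N%:R in
  (forall u : nat -> 'rV[R]_d -> R,
     measurable_fun Omega (u 0%N) ->
     WCS Omega alpha kappa tau N u ->
     (Lp_norm Omega +oo%E (u 0%N) <= 1)%E ->
     forall n, (1 <= n <= N)%N -> (Lp_norm Omega +oo%E (u n) <= 1)%E)
  /\
  (2 <= S + tau `^ (- alpha) ->
   forall u : nat -> 'rV[R]_d -> R,
     measurable_fun Omega (u 0%N) ->
     LWS Omega alpha kappa tau S N u ->
     (Lp_norm Omega +oo%E (u 0%N) <= 1)%E ->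
     forall n, (1 <= n <= N)%N -> (Lp_norm Omega +oo%E (u n) <= 1)%E).
Proof.
move=> tau.
have htau : 0 < tau by rewrite divr_gt0// ltr0n.
have [oO _ _ _ _] := hOmega.
have c0 : 0 < tau `^ (- alpha) by exact: powR_gt0.
split=> [|hc] u _ sol.
  apply: (discrete_maximum_principle halpha htau oO sol) => n x.
  (* With a = u_n, g the extrapolation and c = tau^(-alpha), the claim for a > 1 is g - a^3 < c (a -
     g): the left side is negative as g <= 1 < a^3, the right side positive. The case a < -1 is
     symmetric. *)
  rewrite dbarE//; move: (u n x) (extrap _ _ _ _ _) (tau `^ _) c0 => a g c c0.
  rewrite ler_norml => /andP[g1 g2]; split=> a1.
    have : 1 < a ^+ 3 by rewrite exprn_egt1.
    have : 0 < c * (a - g) by rewrite mulr_gt0//; lra.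
    lra.
  have : 1 < (- a) ^+ 3 by rewrite exprn_egt1// ltrNr.
  rewrite exprNn -signr_odd/= expr1 mulN1r => a3.
  have : 0 < c * (g - a) by rewrite mulr_gt0//; lra.
  lra.
apply: (discrete_maximum_principle halpha htau oO sol) => n x.
rewrite dbarE//; move: (u n x) (extrap _ _ _ _ _) (tau `^ _) c0 hc => a g c c0 hc.
rewrite ler_norml => /andP[g1 g2].
have cS : 0 < c + S by rewrite addr_gt0.
have cS2 : 0 <= c + S - 2 by lra.
have [g1' g2' g3 g4] : [/\ 0 <= 1 + g, 0 <= 1 - g, 0 <= 2 + g & 0 <= 2 - g].
  by split; lra.
split=> a1; rewrite -subr_gt0.
  (* Here w - f = (c + S)(a - g) - g + g^3. Writing a - g = (a - 1) + (1 - g) leaves the factor c +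
     S - g - g^2 on 1 - g, and 2 - g - g^2 = (1 - g)(2 + g). The constant 2 in the constraint is the
     maximum of g + g^2 on [-1, 1]. *)
  rewrite (_ : _ - _ = (c + S) * (a - 1) + (1 - g) * ((c + S - 2) + (1 - g) * (2 + g))).
    rewrite ltr_pwDl//; first by rewrite mulr_gt0// subr_gt0.
    by rewrite mulr_ge0// (addr_ge0 cS2)// mulr_ge0.
  by ring.
(* The same decomposition with a and g replaced by their opposites. *)
rewrite (_ : _ - _ = (c + S) * (- 1 - a) + (1 + g) * ((c + S - 2) + (1 + g) * (2 - g))).
  rewrite ltr_pwDl//; first by rewrite mulr_gt0//; lra.
  by rewrite mulr_ge0// (addr_ge0 cS2)// mulr_ge0.
by ring.
Qed.
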